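(* It holds $$\mathcal O=\{\Omega\subset D:\ \Omega\text{ is a domain of class }C^2\text{ that contains }E,\ \partial\Omega\cap\partial D=\emptyset\}.$$
   Context: $D\subset\mathbb{R}^2$ is a bounded domain of class $C^{1,1}$; $E\subset D$ is a domain with $\mathrm{dist}(\overline E,\partial D)>0$. For $g\in C(\overline D)$ put $\Omega_g:=\mathrm{int}\{x\in D: g(x)\le 0\}$. The set of admissible shape functions is $$\mathcal F_{\mathfrak s}:=\{g\in C^2(\overline D): g(x)<0\ \forall x\in E,\ |\nabla g(x)|+|g(x)|>0\ \forall x\in D,\ g(x)>0\ \forall x\in\partial D\},$$ and the set of admissible shapes is $$\mathcal O:=\{\text{the connected component of }\Omega_g\text{ that contains }E:\ g\in\mathcal F_{\mathfrak s}\}.$$ A domain is an open connected set. *)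

(* Defs.v *)
From HB Require Import structures.
From mathcomp Require Import all_boot all_order all_algebra.
From mathcomp Require Import all_classical all_reals all_analysis.

Set Implicit Arguments.
Unset Strict Implicit.
Unset Printing Implicit Defensive.

Import Order.TTheory GRing.Theory Num.Theory.
Import numFieldNormedType.Exports.

Local Open Scope classical_set_scope.
Local Open Scope ring_scope.

Definition boundary (T : topologicalType) (A : set T) : set T :=
  closure A `\` interior A.

Definition is_domain (T : topologicalType) (A : set T) : Prop :=
  open A /\ connected A.

Section Plane.
Variable R : realType.
Implicit Types (A D E W : set 'rV[R]_2) (f g : 'rV[R]_2 -> R).

(* The library norm on ['rV[R]_2] is the maximum norm. *)
Definition eucl_norm (v : 'rV[R]_2) : R := Num.sqrt (\sum_i v 0 i ^+ 2).

Definition set_dist A B : \bar R :=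
  ereal_inf [set (eucl_norm (x - y))%:E | x in A & y in B].

Definition partial (i : 'I_2) f (x : 'rV[R]_2) : R := 'D_(delta_mx 0 i) f x.

Definition grad f (x : 'rV[R]_2) : 'rV[R]_2 := \row_i partial i f x.

Definition extends_continuously D f : Prop :=
  exists2 F : 'rV[R]_2 -> R, {within closure D, continuous F} & {in D, f =1 F}.

(* All partial derivatives of order at most k exist in the open set D and
   extend continuously to the closure of D. *)
Fixpoint derivs_extend (k : nat) D f : Prop :=
  extends_continuously D f /\
  if k is k'.+1 then
    forall i : 'I_2, (forall x, D x -> derivable f x (delta_mx 0 i)) /\
                     derivs_extend k' D (partial i f)
  else True.

(* Functions on the closure of D are represented by total functions, whose
   values outside that closure are irrelevant here and below. *)
Definition Ck_closure (k : nat) D g : Prop :=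
  {within closure D, continuous g} /\ derivs_extend k D g.

Definition Ck_line (k : nat) (phi : R -> R) : Prop :=
  forall n : nat, (n <= k)%N ->
    continuous (derive1n n phi) /\
    ((n < k)%N -> forall t, derivable (derive1n n phi) t 1).

Definition C11_line (phi : R -> R) : Prop :=
  Ck_line 1 phi /\ lipschitz (derive1 phi).

(* Near each of its boundary points, and in suitable Cartesian coordinates
   [x *m Q], the set A is the strict epigraph of a function from [reg].  Only
   the germ of the function matters, so it may be taken on the whole line. *)
Definition locally_epigraph (reg : set (R -> R)) A : Prop :=
  forall x0, boundary A x0 ->
    exists (Q : 'M[R]_2) (phi : R -> R),
      [/\ Q *m Q^T = 1%:M, reg phi &
          \forall x \near x0, A x <-> phi ((x *m Q) 0 0) < (x *m Q) 0 1].

Definition of_class_Ck (k : nat) A : Prop := locally_epigraph (Ck_line k) A.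

Definition of_class_C11 A : Prop := locally_epigraph C11_line A.

Definition sublevel D g : set 'rV[R]_2 := interior [set x | D x /\ g x <= 0].

Definition shape_functions D E : set ('rV[R]_2 -> R) :=
  [set g | [/\ Ck_closure 2 D g,
               (forall x, E x -> g x < 0),
               (forall x, D x -> 0 < eucl_norm (grad g x) + `|g x|) &
               (forall x, boundary D x -> 0 < g x)]].

Definition component_containing A E W : Prop :=
  (exists2 x, A x & W = connected_component A x) /\ E `<=` W.

Definition admissible_shapes D E : set (set 'rV[R]_2) :=
  [set W | exists2 g, shape_functions D E g &
                      component_containing (sublevel D g) E W].

End Plane.

(* Main.v *)
Require Import Defs.
From HB Require Import structures.
From mathcomp Require Import all_boot all_order all_algebra.
From mathcomp Require Import all_classical all_reals all_analysis.
From mathcomp Require Import ring lra.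

Import Order.TTheory GRing.Theory Num.Theory.
Import numFieldNormedType.Exports.

Local Open Scope classical_set_scope.
Local Open Scope ring_scope.

Set Implicit Arguments.
Unset Strict Implicit.
Unset Printing Implicit Defensive.

(** Two constructions prove the two inclusions.

    Let [g] be a shape function and [W] a component of its sublevel set.  As
    [g] is positive on the boundary of [D], the closure of [W] lies in [D], and
    [g] vanishes on the boundary of [W], for otherwise the boundary point would
    be interior.  Hence the gradient does not vanish there, and the implicit
    function theorem ([implicit_C2], used through [level_set_graph]) shows that
    near such a point the sublevel set is the strict epigraph of a C2 function.
    A local epigraph is connected, so the component contains all of it
    ([component_of_class_C2]).

    Conversely, let [W] be a C2 domain whose closure lies in [D].  Each point of
    the plane has a neighbourhood on which [W] is the negativity set of an
    explicit C2 function: -1 inside [W], 1 outside its closure, and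
    [f ((x *m Q) 0 0) - (x *m Q) 0 1] at a boundary point where [W] is an
    epigraph.  The products of these functions with bumps have the right weak
    signs everywhere, and by compactness of the closure of [D] finitely many of
    them add up to a function [q] that is negative in [W], zero on its boundary
    and positive elsewhere in the closure of [D] ([exists_defining_on]).  No
    cancellation of gradients occurs on the boundary, because along a direction
    entering [W] each summand has a nonpositive derivative
    ([weakly_defining_inward]) and one of them a negative derivative.  So [q] is
    a shape function, and the interior of its nonpositivity set is [W]
    ([sublevel_defining]), which is connected. *)

(** * One variable: gluing and C2 extension *)

Section Slope.
Variable R : realType.
Implicit Types (f g A : R -> R) (a x d : R).

(** Caratheodory's criterion with the factorisation required only near [x]: away
    from there the slope is replaced by the true difference quotient.
    Slopes turn limits of quotients into algebra on continuous functions. *)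
Lemma slope_is_derive f A x :
  (\forall y \near x, f y - f x = A y * (y - x)) ->
  {for x, continuous A} -> is_derive x 1 f (A x).
Proof.
move=> fA cA; apply/is_derive1_caratheodory.
pose B y := if f y - f x == A y * (y - x) then A y else (f y - f x) / (y - x).
have Bx : B x = A x by rewrite /B !subrr mulr0 eqxx.
have nearB : \forall y \near x, A y = B y.
  by apply: filterS fA => y fAy; rewrite /B fAy eqxx.
exists B; split => //.
- move=> y; rewrite /B; case: eqP => // neq; rewrite divfK // subr_eq0.
  by apply/eqP => yx; apply: neq; rewrite yx !subrr mulr0.
- rewrite /prop_for /continuous_at Bx; apply: cvg_trans cA.
  exact: near_eq_cvg.
Qed.

Lemma is_derive_continuous f x d : is_derive x 1 f d -> {for x, continuous f}.
Proof.
by move=> [fx _]; apply: differentiable_continuous; apply/derivable1_diffP.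
Qed.

Lemma near_dist_lt (T : topologicalType) (h : T -> R) (z : T) (c k : R) :
  {for z, continuous h} -> `|h z - c| < k -> \forall y \near z, `|h y - c| < k.
Proof.
move=> ch; have : (fun y => `|h y - c|) @ z --> `|h z - c|.
  by apply: cvg_norm; apply: cvgB => //; exact: cvg_cst.
by move=> /cvgr_lt H hz; exact: H.
Qed.

Lemma near0_ex (P : R -> Prop) : (\forall u \near (0 : R), P u) ->
  exists2 e, 0 < e & P e /\ P (- e).
Proof.
move=> /nbhs_ballP [e /= e0 eP]; exists (e / 2); first by rewrite divr_gt0.
by split; apply: eP; rewrite /ball /= sub0r ?opprK ?normrN gtr0_norm; lra.
Qed.

Definition glue a f g x := if x <= a then f x else g x.

Lemma glueP a f g x : f a = g a -> a <= x -> glue a f g x = g x.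
Proof. by move=> fg; rewrite /glue; case: (ltgtP x a) => // ->. Qed.

Lemma glue_near_lt a f g x : x < a -> \forall y \near x, f y = glue a f g y.
Proof.
by move=> xa; near=> y; rewrite /glue ltW //; near: y; exact: lt_nbhsl.
Unshelve. all: by end_near. Qed.

Lemma glue_near_gt a f g x : a < x -> \forall y \near x, g y = glue a f g y.
Proof.
move=> xa; near=> y; rewrite /glue leNgt.
by have -> : a < y by near: y; exact: lt_nbhsr.
Unshelve. all: by end_near. Qed.

Lemma glue_continuous_at a f g : f a = g a ->
  {for a, continuous f} -> {for a, continuous g} ->
  {for a, continuous (glue a f g)}.
Proof.
move=> fg cf cg; rewrite /prop_for /continuous_at /glue lexx.
apply/cvgrPdist_lt => e e0.
move/cvgrPdist_lt: cf => /(_ e e0) cf.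
move/cvgrPdist_lt: cg => /(_ e e0) cg.
near=> y; case: ifP => _; first by near: y; exact: cf.
by rewrite fg; near: y; exact: cg.
Unshelve. all: by end_near. Qed.

Lemma glue_continuous a f g x : f a = g a ->
  (x <= a -> {for x, continuous f}) -> (a <= x -> {for x, continuous g}) ->
  {for x, continuous (glue a f g)}.
Proof.
move=> fg cf cg; case: (ltgtP x a) => xa.
- rewrite /prop_for /continuous_at -(nbhs_singleton (glue_near_lt f g xa)).
  apply: cvg_trans (cf (ltW xa)); apply: near_eq_cvg.
  exact: glue_near_lt.
- rewrite /prop_for /continuous_at -(nbhs_singleton (glue_near_gt f g xa)).
  apply: cvg_trans (cg (ltW xa)); apply: near_eq_cvg.
  exact: glue_near_gt.
- by move: cf cg; rewrite xa lexx => cf cg; apply: glue_continuous_at; auto.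
Qed.

Lemma is_derive_glue a f g f' g' x : f a = g a -> f' a = g' a ->
  (x <= a -> is_derive x 1 f (f' x)) -> (a <= x -> is_derive x 1 g (g' x)) ->
  is_derive x 1 (glue a f g) (glue a f' g' x).
Proof.
move=> fg fg' df dg; case: (ltgtP x a) => xa.
- rewrite -(nbhs_singleton (glue_near_lt f' g' xa)).
  exact: near_eq_is_derive (glue_near_lt f g xa) (df (ltW xa)).
- rewrite -(nbhs_singleton (glue_near_gt f' g' xa)).
  exact: near_eq_is_derive (glue_near_gt f g xa) (dg (ltW xa)).
- (* At the junction, the slope of the glued function is the gluing of the
     slopes. *)
  have /is_derive1_caratheodory [A [A3 A2 A1]] : is_derive a 1 f (f' a).
    by rewrite -xa; apply: df; rewrite xa.
  have /is_derive1_caratheodory [B [B3 B2 B1]] : is_derive a 1 g (g' a).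
    by rewrite -xa; apply: dg; rewrite xa.
  have -> : glue a f' g' x = glue a A B a by rewrite /glue xa lexx A1.
  have fgS y : glue a f g y - glue a f g a = glue a A B y * (y - a).
    by rewrite {2}/glue lexx /glue; case: ifP => _ //; rewrite fg.
  rewrite xa; apply: slope_is_derive; first by near=> y; exact: fgS.
  by apply: glue_continuous_at => //; rewrite A1 B1.
Unshelve. all: by end_near. Qed.

Lemma Ck_line2_intro (f f1 f2 : R -> R) :
  (forall x, is_derive x 1 f (f1 x)) -> (forall x, is_derive x 1 f1 (f2 x)) ->
  continuous f2 -> Ck_line 2 f.
Proof.
move=> d1 d2 c2.
have e1 : derive1 f = f1 by apply/funext => x; rewrite derive1E derive_val.
have e2 : derive1 f1 = f2 by apply/funext => x; rewrite derive1E derive_val.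
case=> [|[|[|//]]] _; rewrite ?derive1nS derive1n0 ?e1 ?e2; split => //.
- by move=> x; exact: is_derive_continuous (d1 x).
- by move=> x; exact: is_derive_continuous (d2 x).
Qed.

(** The cube is the smallest integer power whose positive part is of class C2. *)
Definition pos_cube : R -> R := glue 0 (cst 0) (fun x => x ^+ 3).

Lemma pos_cube_C2 : Ck_line 2 pos_cube.
Proof.
apply: (@Ck_line2_intro _ (glue 0 (cst 0) (fun x => 3%:R * x ^+ 2))
                          (glue 0 (cst 0) (fun x => 6%:R * x))).
- move=> x; apply: is_derive_glue; [by rewrite /= ?expr0n /= ?mulr0..|].
  by move=> _; apply: is_derive_eq; rewrite /GRing.scale /=; ring.
- move=> x; apply: is_derive_glue; [by rewrite /= ?expr0n /= ?mulr0..|].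
  by move=> _; apply: is_derive_eq; rewrite /GRing.scale /=; ring.
- move=> x; apply: glue_continuous => [|_|_]; first by rewrite mulr0.
    exact: cvg_cst.
  by apply: cvgMl_tmp; exact: cvg_id.
Qed.

Lemma pos_cube_ge0 x : 0 <= pos_cube x.
Proof.
by rewrite /pos_cube /glue; case: (leP x 0) => //= x0; rewrite exprn_ge0 // ltW.
Qed.

Lemma pos_cube_gt0 x : (0 < pos_cube x) = (0 < x).
Proof.
by rewrite /pos_cube /glue; case: (leP x 0) => x0 /=; rewrite ?ltxx ?exprn_gt0.
Qed.

Definition taylor2 (a c0 c1 c2 : R) x :=
  c0 + c1 * (x - a) + c2 / 2 * (x - a) ^+ 2.

(** The germ of a C2 function is continued to the whole line by its Taylor
    polynomials of order two at the ends of a smaller interval: values and both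
    derivatives match there, so the glued function is still C2. *)
Lemma C2_extension (f f1 f2 : R -> R) (s r : R) : 0 < r ->
  (forall x, `|x - s| < r -> is_derive x 1 f (f1 x)) ->
  (forall x, `|x - s| < r -> is_derive x 1 f1 (f2 x)) ->
  (forall x, `|x - s| < r -> {for x, continuous f2}) ->
  exists2 F, Ck_line 2 F & forall x, `|x - s| < r / 2 -> F x = f x.
Proof.
move=> r0 d1 d2 c2; pose a := s - r / 2; pose b := s + r / 2.
have ab : a <= b by rewrite /a /b; lra.
pose Ta := taylor2 a (f a) (f1 a) (f2 a).
pose Tb := taylor2 b (f b) (f1 b) (f2 b).
pose Ta1 x := f1 a + f2 a * (x - a); pose Tb1 x := f1 b + f2 b * (x - b).
have dT c c0 c1' c2' x :
    is_derive x 1 (taylor2 c c0 c1' c2') (c1' + c2' * (x - c)).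
  rewrite /taylor2; apply: is_derive_eq; rewrite /GRing.scale /=.
  by field.
have dT1 c c1' c2' x : is_derive x 1 (fun x => c1' + c2' * (x - c)) c2'.
  by apply: is_derive_eq; rewrite /GRing.scale /=; ring.
pose G2 := glue a Ta (glue b f Tb).
have in_ab x : a <= x -> x <= b -> `|x - s| < r.
  by rewrite /a /b => h1 h2; rewrite ltr_distl; apply/andP; split; lra.
have tE c c0 c1' c2' : taylor2 c c0 c1' c2' c = c0.
  by rewrite /taylor2 subrr expr0n /= !mulr0 !addr0.
have gaE (u v : R -> R) : glue b u v a = u a by rewrite /glue ab.
have T1E c c1' c2' : c1' + c2' * (c - c) = c1' :> R.
  by rewrite subrr mulr0 addr0.
exists G2; last first.
  move=> x; rewrite ltr_distl => /andP[h1 h2].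
  have ax : a <= x by rewrite /a; lra.
  rewrite /G2 glueP //; last by rewrite gaE /Ta tE.
  by rewrite /glue ifT // /b; lra.
apply: (@Ck_line2_intro _ (glue a Ta1 (glue b f1 Tb1))
                          (glue a (cst (f2 a)) (glue b f2 (cst (f2 b))))).
- move=> x; apply: is_derive_glue; rewrite ?gaE /Ta ?tE /Ta1 ?T1E // => ax.
  apply: is_derive_glue; rewrite /Tb ?tE /Tb1 ?T1E // => xb.
  by apply: d1; exact: in_ab.
- move=> x; apply: is_derive_glue; rewrite ?gaE /Ta1 ?T1E // => ax.
  apply: is_derive_glue; rewrite /Tb1 ?T1E // => xb.
  by apply: d2; exact: in_ab.
- move=> x; apply: glue_continuous => [|_|ax]; rewrite ?gaE //.
    exact: cvg_cst.
  apply: glue_continuous => [|xb|_] //; last exact: cvg_cst.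
  by apply: c2; exact: in_ab.
Qed.

End Slope.

(** * Two variables: the implicit function theorem in class C2 *)

Section Implicit.
Variable R : realType.
Implicit Types (F G : R * R -> R) (p q : R * R).

Lemma MVT_between (f f' : R -> R) (x y : R) :
  (forall z, x <= z <= y \/ y <= z <= x -> is_derive z 1 f (f' z)) ->
  exists2 c, x <= c <= y \/ y <= c <= x & f y - f x = f' c * (y - x).
Proof.
wlog xy : x y / x <= y => [hwlog df|df].
  case: (leP x y) => [|/ltW] xy; first exact: hwlog.
  have [|c hc e] := hwlog y x xy; first by move=> z hz; apply: df; tauto.
  by exists c; [tauto|rewrite -opprB e; ring].
have [z /andP[xz zy]||c] := @MVT_segment _ f f' x y xy.
- by apply: df; left; rewrite !ltW.
- apply: derivable_within_continuous => z; rewrite in_itv /= => hz.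
  by have [] := df z (or_introl hz).
- by rewrite in_itv /= => hc e; exists c => //; left.
Qed.

Definition C1_on (B : set (R * R)) F Fs Ft := forall p, B p ->
  [/\ is_derive p.1 1 (fun s => F (s, p.2)) (Fs p),
      is_derive p.2 1 (fun t => F (p.1, t)) (Ft p),
      {for p, continuous Fs} & {for p, continuous Ft}].

Lemma ball_between (x r y z c : R) : ball x r y -> ball x r z ->
  y <= c <= z \/ z <= c <= y -> ball x r c.
Proof.
rewrite /ball /= !ltr_distlC => /andP[? ?] /andP[? ?].
by case=> /andP[? ?]; apply/andP; split; lra.
Qed.

Lemma between_dist (x y c : R) : x <= c <= y \/ y <= c <= x ->
  `|x - c| <= `|x - y|.
Proof.
case=> /andP[h1 h2].
  by rewrite ler0_norm ?ler0_norm; lra.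
by rewrite ger0_norm ?ger0_norm; lra.
Qed.

Lemma between_refl (x y : R) : x <= x <= y \/ y <= x <= x.
Proof. by rewrite !lexx andbT /=; case: (leP x y) => [|/ltW]; auto. Qed.

(** The two-variable version of Caratheodory's slope: going from [p0] to [p]
    first along the second axis and then along the first one, the mean value
    theorem gives [A p] and [B p] as partial derivatives at points between [p0]
    and [p], whence their continuity at [p0].  Both the chain rule along a graph
    and the derivative of the implicit function follow from it by algebra. *)
Lemma C1_slope q d F Fs Ft p0 : C1_on (ball q d) F Fs Ft -> ball q d p0 ->
  exists A B : R * R -> R,
    [/\ A p0 = Fs p0 /\ B p0 = Ft p0,
        {for p0, continuous A}, {for p0, continuous B} &
        forall p, ball q d p ->
          F p - F p0 = A p * (p.1 - p0.1) + B p * (p.2 - p0.2)].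
Proof.
move=> C1F p0B.
have xiP p : exists c, (p0.1 <= c <= p.1 \/ p.1 <= c <= p0.1) /\
    (ball q d p -> F p - F (p0.1, p.2) = Fs (c, p.2) * (p.1 - p0.1)).
  have [pB|npB] := pselect (ball q d p); last first.
    by exists p0.1; split=> //; exact: between_refl.
  have [|c hc e] := @MVT_between (fun s => F (s, p.2))
      (fun s => Fs (s, p.2)) p0.1 p.1.
    move=> z hz; have [] // := C1F (z, p.2).
    split=> /=; [exact: (ball_between p0B.1 pB.1)|exact: pB.2].
  by exists c; split=> // _; rewrite -e; case: (p).
have etaP p : exists c, (p0.2 <= c <= p.2 \/ p.2 <= c <= p0.2) /\
    (ball q d p -> F (p0.1, p.2) - F p0 = Ft (p0.1, c) * (p.2 - p0.2)).
  have [pB|npB] := pselect (ball q d p); last first.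
    by exists p0.2; split=> //; exact: between_refl.
  have [|c hc e] := @MVT_between (fun t => F (p0.1, t))
      (fun t => Ft (p0.1, t)) p0.2 p.2.
    move=> z hz; have [] // := C1F (p0.1, z).
    split=> /=; [exact: p0B.1|exact: (ball_between p0B.2 pB.2)].
  by exists c; split=> // _; rewrite -e; case: (p0).
have [xi xiH] := choice xiP; have [eta etaH] := choice etaP.
have xi0 : xi p0 = p0.1.
  by case: (xiH p0) => + _; case=> /andP[h1 h2]; apply/le_anti/andP.
have eta0 : eta p0 = p0.2.
  by case: (etaH p0) => + _; case=> /andP[h1 h2]; apply/le_anti/andP.
have [_ _ cFs cFt] := C1F p0 p0B.
exists (fun p => Fs (xi p, p.2)), (fun p => Ft (p0.1, eta p)); split.
- by rewrite xi0 eta0; case: (p0).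
- rewrite /prop_for /continuous_at xi0 -surjective_pairing.
  apply/cvgrPdist_lt => e e0.
  have /nbhs_ballP[r /= r0 rH] : \forall p \near p0, `|Fs p0 - Fs p| < e.
    by move/cvgrPdist_lt: cFs; apply.
  suff : \forall p \near p0, `|Fs p0 - Fs (xi p, p.2)| < e by [].
  apply/nbhs_ballP; exists r => //= p [p1 p2].
  apply: rH; split => //=; rewrite /ball /=.
  exact: le_lt_trans (between_dist (xiH p).1) p1.
- rewrite /prop_for /continuous_at eta0 -surjective_pairing.
  apply/cvgrPdist_lt => e e0.
  have /nbhs_ballP[r /= r0 rH] : \forall p \near p0, `|Ft p0 - Ft p| < e.
    by move/cvgrPdist_lt: cFt; apply.
  suff : \forall p \near p0, `|Ft p0 - Ft (p0.1, eta p)| < e by [].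
  apply/nbhs_ballP; exists r => //= p [p1 p2].
  apply: rH; split => /=; first exact: ballxx.
  exact: le_lt_trans (between_dist (etaH p).1) p2.
- move=> p pB; rewrite -(xiH p).2 // -(etaH p).2 //; ring.
Qed.

Lemma graph_cvg (f : R -> R) (x : R) :
  {for x, continuous f} -> (fun s => (s, f s)) @ x --> (x, f x).
Proof.
by move=> cf; apply: (@cvg_pair _ _ _ _ (nbhs x) (nbhs (f x))).
Qed.

Lemma graph_continuous (F : R * R -> R) (f : R -> R) (x : R) :
  {for x, continuous f} -> {for (x, f x), continuous F} ->
  {for x, continuous (fun s => F (s, f s))}.
Proof.
by move=> cf cF; exact: (cvg_comp _ _ (graph_cvg cf) cF).
Qed.

Lemma graph_near q d (f : R -> R) (x : R) : ball q d (x, f x) ->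
  {for x, continuous f} -> \forall s \near x, ball q d (s, f s).
Proof.
move=> xB cf; apply: (graph_cvg cf); apply: open_nbhs_nbhs; split => //.
exact: ball_open.
Qed.

Lemma is_derive_graph q d F Fs Ft (f : R -> R) (x m : R) :
  C1_on (ball q d) F Fs Ft -> ball q d (x, f x) -> is_derive x 1 f m ->
  is_derive x 1 (fun s => F (s, f s)) (Fs (x, f x) + Ft (x, f x) * m).
Proof.
move=> C1F xB df; have cf := is_derive_continuous df.
have [A [B [[<- <-] cA cB FAB]]] := C1_slope C1F xB.
have /is_derive1_caratheodory [M [fM cM <-]] := df.
apply: (@slope_is_derive _ _ (fun s => A (s, f s) + B (s, f s) * M s)).
  apply: filterS (graph_near xB cf) => s sB /=.
  by rewrite FAB //= fM; ring.
by apply: cvgD; [|apply: cvgM]; [exact: graph_continuous..|exact: cM].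
Qed.

(** As [G] strictly decreases in its second variable, its sign on the two
    horizontal edges of a small box forces, on each vertical segment, a unique
    zero [f s] that separates the signs of [G].  Monotonicity gives the
    continuity of [f], [C1_slope] gives [f' = - Gs / Gt] along the graph, and
    this expression is again differentiable.  The last step replaces [f] by a
    C2 function on the whole line with the same germ. *)
Lemma implicit_C2 (s0 t0 d : R) G Gs Gt Gss Gst Gts Gtt : 0 < d ->
  C1_on (ball (s0, t0) d) G Gs Gt ->
  C1_on (ball (s0, t0) d) Gs Gss Gst -> C1_on (ball (s0, t0) d) Gt Gts Gtt ->
  (forall p, ball (s0, t0) d p -> Gt p < 0) -> G (s0, t0) = 0 ->
  exists (r : R) (f : R -> R), [/\ 0 < r, r <= d, Ck_line 2 f &
    forall s, `|s - s0| < r -> [/\ `|f s - t0| < d,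
      forall t, `|t - t0| < d -> t < f s -> 0 < G (s, t) &
      forall t, `|t - t0| < d -> f s < t -> G (s, t) < 0]].
Proof.
move=> d0 C1G C1Gs C1Gt Gt0 G0.
have inB s t : `|s - s0| < d -> `|t - t0| < d -> ball (s0, t0) d (s, t).
  by move=> h1 h2; split; rewrite /ball /= distrC.
have mono s t t' : `|s - s0| < d -> `|t - t0| < d -> `|t' - t0| < d -> t < t' ->
    G (s, t') < G (s, t).
  move=> hs ht ht' tt'.
  have [|c hc e] := @MVT_between (fun u => G (s, u)) (fun u => Gt (s, u)) t t'.
    move=> z hz; have [|] // := C1G (s, z).
    split=> /=; first by rewrite /ball /= distrC.
    by apply: ball_between hz; rewrite /ball /= distrC.
  rewrite -subr_lt0 e pmulr_llt0 ?subr_gt0 //; apply: Gt0.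
  split=> /=; first by rewrite /ball /= distrC.
  by apply: ball_between hc; rewrite /ball /= distrC.
have cGs s t : `|s - s0| < d -> `|t - t0| < d ->
    {for s, continuous (fun u => G (u, t))}.
  by move=> hs ht; have [/is_derive_continuous] := C1G _ (inB _ _ hs ht).
have cGt s t : `|s - s0| < d -> `|t - t0| < d ->
    {for t, continuous (fun u => G (s, u))}.
  by move=> hs ht; have [_ /is_derive_continuous] := C1G _ (inB _ _ hs ht).
pose e := d / 2.
have he u : `|u| <= e -> `|(t0 + u) - t0| < d.
  by rewrite addrAC subrr add0r /e => h; apply: le_lt_trans h _; lra.
have e0 : 0 < e by rewrite /e; lra.
have ee : `|e| <= e by rewrite gtr0_norm.
have eN : `|- e| <= e by rewrite normrN gtr0_norm.
have hs0 : `|s0 - s0| < d by rewrite subrr normr0.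
have ht0 : `|t0 - t0| < d by rewrite subrr normr0.
have Gp : 0 < G (s0, t0 - e) by rewrite -G0; apply: mono => //; [exact: he|lra].
have Gm : G (s0, t0 + e) < 0 by rewrite -G0; apply: mono => //; [exact: he|lra].
have [r [r0 rd rP]] : exists r, [/\ 0 < r, r <= d & forall s, `|s - s0| < r ->
    0 < G (s, t0 - e) /\ G (s, t0 + e) < 0].
  have : \forall s \near s0, 0 < G (s, t0 - e) /\ G (s, t0 + e) < 0.
    near=> s; split; near: s.
      have /cvgr_gt : {for s0, continuous (fun u => G (u, t0 - e))}.
        by apply: cGs => //; exact: he.
      exact.
    have /cvgr_lt : {for s0, continuous (fun u => G (u, t0 + e))}.
      by apply: cGs => //; exact: he.
    exact.
  move=> /nbhs_ballP[r /= r0 rH]; exists (Num.min r d); split.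
  - by rewrite lt_min r0 d0.
  - by rewrite ge_min lexx orbT.
  - move=> s; rewrite lt_min => /andP[h _].
    by apply: rH; rewrite /ball /= distrC.
have fP s : exists t, `|s - s0| < r -> `|t - t0| < d /\ G (s, t) = 0.
  case: (ltP `|s - s0| r) => sr; last by exists 0.
  have sd := lt_le_trans sr rd.
  have [|||t] := @IVT _ (fun u => G (s, u)) (t0 - e) (t0 + e) 0; first by lra.
  - apply: continuous_in_subspaceT => z.
    rewrite inE /= in_itv /= => /andP[h1 h2].
    apply: cGt => //; rewrite ltr_norml; apply/andP; rewrite /e in h1 h2.
    by clear - h1 h2 d0; split; lra.
  - have [h1 h2] := rP s sr; rewrite ge_min le_max (ltW h1) (ltW h2) orbT //.
  rewrite in_itv /= => /andP[h1 h2] Gst0; exists t => _; split=> //.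
  rewrite ltr_norml; apply/andP; rewrite /e in h1 h2.
  by clear - h1 h2 d0; split; lra.
have {fP} [f fP] := choice fP.
have pos s t : `|s - s0| < r -> `|t - t0| < d -> t < f s -> 0 < G (s, t).
  move=> sr td tf; have [h1 <-] := fP s sr.
  exact: mono (lt_le_trans sr rd) td h1 tf.
have neg s t : `|s - s0| < r -> `|t - t0| < d -> f s < t -> G (s, t) < 0.
  move=> sr td tf; have [h1 <-] := fP s sr.
  exact: mono (lt_le_trans sr rd) h1 td tf.
have near_r s : `|s - s0| < r -> \forall u \near s, `|u - s0| < r.
  exact: (@near_dist_lt _ _ id).
have cf s : `|s - s0| < r -> {for s, continuous f}.
  move=> sr; apply/cvgrPdist_lt => eps eps0.
  have [fd _] := fP s sr.
  (* The test points [f s + k] and [f s - k] must stay inside the box. *)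
  pose m := Num.min eps (d - `|f s - t0|); pose k := m / 2.
  have m0 : 0 < m by rewrite lt_min eps0 subr_gt0 fd.
  have meps : m <= eps by rewrite ge_min lexx.
  have md : m <= d - `|f s - t0| by rewrite ge_min lexx orbT.
  have [k0 keps kd] : [/\ 0 < k, k < eps & k < d - `|f s - t0|].
    by rewrite /k; clear - m0 meps md; split; lra.
  have kp : `|f s + k - t0| < d.
    rewrite addrAC; apply: le_lt_trans (ler_normD _ _) _.
    by rewrite (gtr0_norm k0) -ltrBrDl.
  have km : `|f s - k - t0| < d.
    rewrite addrAC; apply: le_lt_trans (ler_normB _ _) _.
    by rewrite (gtr0_norm k0) -ltrBrDl.
  have sd := lt_le_trans sr rd.
  near=> u.
  have ur : `|u - s0| < r.
    by near: u; exact: near_r.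
  have G1 : 0 < G (u, f s - k).
    near: u; have /cvgr_gt := cGs s (f s - k) sd km; apply.
    by apply: pos => //; rewrite ltrBlDr ltrDl.
  have G2 : G (u, f s + k) < 0.
    near: u; have /cvgr_lt := cGs s (f s + k) sd kp; apply.
    by apply: neg => //; rewrite ltrDl.
  apply: (le_lt_trans _ keps); rewrite ler_distl; apply/andP; split.
    rewrite leNgt; apply/negP => h; have := pos u (f s + k) ur kp.
    by rewrite -ltrBDr => /(_ h); rewrite ltNge (ltW G2).
  rewrite leNgt; apply/negP => h; have := neg u (f s - k) ur km.
  by rewrite ltrBDr => /(_ h); rewrite ltNge (ltW G1).
pose f1 s := - Gs (s, f s) / Gt (s, f s).
have fB s : `|s - s0| < r -> ball (s0, t0) d (s, f s).
  by move=> sr; have [h _] := fP s sr; apply: inB => //; exact: lt_le_trans rd.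
have df s : `|s - s0| < r -> is_derive s 1 f (f1 s).
  move=> sr; have [A [B [[A0 B0] cA cB GAB]]] := C1_slope C1G (fB s sr).
  rewrite (_ : f1 s = - A (s, f s) / B (s, f s)); last by rewrite /f1 A0 B0.
  have cA' := graph_continuous (cf s sr) cA.
  have cB' := graph_continuous (cf s sr) cB.
  have Bs0 : B (s, f s) < 0 by rewrite B0; apply: Gt0; exact: fB.
  apply: (@slope_is_derive _ f (fun u => - A (u, f u) / B (u, f u))).
    near=> u.
    have ur : `|u - s0| < r by near: u; exact: near_r.
    have Bu : B (u, f u) < 0.
      by near: u; move/cvgr_lt: cB'; apply.
    have := GAB _ (fB u ur); rewrite (fP u ur).2 (fP s sr).2 subrr /= => h.
    apply: (mulfI (lt0r_neq0 (_ : 0 < - B (u, f u)))).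
      by rewrite oppr_gt0.
    have Bu0 : B (u, f u) != 0 by rewrite lt_eqF.
    have -> : - B (u, f u) * (- A (u, f u) / B (u, f u) * (u - s)) =
        A (u, f u) * (u - s).
      by field.
    by apply/esym/eqP; rewrite mulNr -addr_eq0 -h.
  apply: cvgM; first by apply: cvgN.
  by apply: cvgV; [rewrite lt_eqF|exact: cB'].
pose a s := Gss (s, f s) + Gst (s, f s) * f1 s.
pose b s := Gts (s, f s) + Gtt (s, f s) * f1 s.
pose f2 s := - a s / Gt (s, f s) + Gs (s, f s) * b s / Gt (s, f s) ^+ 2.
have Gtn0 s : `|s - s0| < r -> Gt (s, f s) != 0.
  by move=> sr; rewrite lt_eqF // Gt0 //; exact: fB.
have df1 s : `|s - s0| < r -> is_derive s 1 f1 (f2 s).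
  move=> sr; have da : is_derive s 1 (fun s => Gs (s, f s)) (a s).
    exact: is_derive_graph C1Gs (fB s sr) (df s sr).
  have db : is_derive s 1 (fun s => Gt (s, f s)) (b s).
    exact: is_derive_graph C1Gt (fB s sr) (df s sr).
  have h := is_deriveM (is_deriveN da) (is_deriveV (Gtn0 s sr) db).
  refine (@is_derive_eq _ _ _ f1 s 1 _ _ h _).
  rewrite /GRing.scale /= opprfctE /f2.
  by have := Gtn0 s sr => ?; field.
have cf1 s : `|s - s0| < r -> {for s, continuous f1}.
  by move=> sr; exact: is_derive_continuous (df1 s sr).
have cf2 s : `|s - s0| < r -> {for s, continuous f2}.
  move=> sr; have [_ _ cGss cGst] := C1Gs _ (fB s sr).
  have [_ _ cGts cGtt] := C1Gt _ (fB s sr).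
  have [_ _ cGs' cGt'] := C1G _ (fB s sr).
  have gr F := @graph_continuous F f s (cf s sr).
  have ca : {for s, continuous a}.
    by apply: cvgD; [exact: gr|apply: cvgM; [exact: gr|exact: cf1]].
  have cb : {for s, continuous b}.
    by apply: cvgD; [exact: gr|apply: cvgM; [exact: gr|exact: cf1]].
  have cV : {for s, continuous (fun u => (Gt (u, f u))^-1)}.
    by apply: cvgV; [exact: Gtn0|exact: gr].
  have cV2 : {for s, continuous (fun u => (Gt (u, f u) ^+ 2)^-1)}.
    apply: cvgV; first by rewrite expf_neq0 // Gtn0.
    by apply: cvgM; exact: gr.
  apply: cvgD; apply: cvgM => //; first exact: cvgN.
  by apply: cvgM => //; exact: gr.
have [F F2 Ff] := C2_extension r0 df df1 cf2.
exists (r / 2), F; split=> //; [lra|lra|].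
move=> s sr2; have sr : `|s - s0| < r by lra.
rewrite Ff //; split; first by have [] := fP s sr.
  by move=> t; exact: pos.
by move=> t; exact: neg.
Unshelve. all: by end_near. Qed.

End Implicit.

(** * Regular level sets in the plane are C2 graphs *)

Section Frame.
Variable R : realType.
Implicit Types (Q : 'M[R]_2) (x : 'rV[R]_2) (p q : R * R) (D : set 'rV[R]_2).

Lemma ord2P (i : 'I_2) : i = 0 \/ i = 1.
Proof. by case: i => -[|[|//]] h; [left|right]; apply/val_inj. Qed.

Lemma sum_ord2 (V : nmodType) (F : 'I_2 -> V) : \sum_i F i = F 0 + F 1.
Proof.
rewrite big_ord_recl big_ord1; congr (_ + F _).
by apply/val_inj.
Qed.

(** The point whose coordinates in the system [x *m Q] are [p]. *)
Definition frame Q p : 'rV[R]_2 := p.1 *: row 0 Q^T + p.2 *: row 1 Q^T.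

Lemma frameK Q x : Q *m Q^T = 1%:M -> frame Q ((x *m Q) 0 0, (x *m Q) 0 1) = x.
Proof.
by move=> QQ; rewrite -[RHS]mulmx1 -QQ mulmxA [RHS]mulmx_sum_row sum_ord2.
Qed.

Lemma frame_coord Q p : Q *m Q^T = 1%:M ->
  (frame Q p *m Q) 0 0 = p.1 /\ (frame Q p *m Q) 0 1 = p.2.
Proof.
move=> /mulmx1C QQ; rewrite mulmxDl -!scalemxAl -!row_mul QQ !mxE /=.
by rewrite !mulr1 !mulr0 addr0 add0r.
Qed.

Lemma frame_continuous Q : continuous (frame Q).
Proof.
move=> p; apply: cvgD; apply: cvgZr_tmp; [exact: cvg_fst|exact: cvg_snd].
Qed.

Lemma coord_mulmx_continuous Q (j : 'I_2) : continuous (fun x => (x *m Q) 0 j).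
Proof.
move=> x; rewrite (_ : (fun x => _) =
    (fun x => x 0 0 * Q 0 j + x 0 1 * Q 1 j)); last first.
  by apply/funext => y; rewrite mxE sum_ord2.
have h i k : (fun y : 'rV[R]_2 => y 0 i * k) @ x --> x 0 i * k.
  exact: cvgMr_tmp (@coord_continuous R 1 2 0 i x).
exact: cvgD (h 0 _) (h 1 _).
Qed.

(** A directional derivative is an ordinary derivative along a line. *)
Lemma is_derive_line (f : 'rV[R]_2 -> R) (y v : 'rV[R]_2) (u d : R) :
  is_derive (y + u *: v) v f d -> is_derive u 1 (fun w => f (y + w *: v)) d.
Proof.
pose q1 h := h^-1 *: ((f \o shift (y + u *: v)) (h *: v) - f (y + u *: v)).
pose q2 (h : R) := h^-1 *:
  (((fun w => f (y + w *: v)) \o shift u) (h *: (1 : R)) - f (y + u *: v)).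
have q12 : q1 = q2.
  apply/funext => h; rewrite /q1 /q2 /= [h *: 1]mulr1 scalerDl.
  by congr (_ *: (f _ - _)); rewrite addrCA.
move=> [fd fv]; apply: DeriveDef.
  by move: fd; rewrite /derivable -/q1 -/q2 q12.
by move: fv; rewrite /derive -/q1 -/q2 q12.
Qed.

Lemma is_derive_line0 (f : 'rV[R]_2 -> R) (x v : 'rV[R]_2) :
  derivable f x v -> is_derive (0 : R) 1 (fun w => f (x + w *: v)) ('D_v f x).
Proof.
move=> fx; apply: is_derive_line; rewrite scale0r addr0; exact: derivableP.
Qed.

Lemma near_line (x v : 'rV[R]_2) (A : set 'rV[R]_2) : nbhs x A ->
  \forall u \near (0 : R), A (x + u *: v).
Proof.
have cl : (fun u : R => x + u *: v) @ (0 : R) --> x + 0 *: v.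
  by apply: cvgD; [exact: cvg_cst|exact: cvgZr_tmp].
by move=> xA; apply: cl; rewrite scale0r addr0.
Qed.

Definition C1_partials D (f : 'rV[R]_2 -> R) := forall x, D x -> forall j,
  derivable f x (delta_mx 0 j) /\ {for x, continuous (partial j f)}.

(** In a frame made of coordinate vectors up to sign the partial derivatives
    are, up to sign, the given ones, so C1 regularity transfers without going
    through total differentiability. *)
Lemma C1_on_frame D f Q (i i' : 'I_2) (s : R) q d : s * s = 1 ->
  row 0 Q^T = delta_mx 0 i' -> row 1 Q^T = s *: delta_mx 0 i ->
  C1_partials D f -> (forall p, ball q d p -> D (frame Q p)) ->
  C1_on (ball q d) (fun p => f (frame Q p))
    (fun p => partial i' f (frame Q p)) (fun p => s * partial i f (frame Q p)).
Proof.
move=> ss Q0 Q1 fok QD p /QD pD.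
have cP (F : 'rV[R]_2 -> R) : {for frame Q p, continuous F} ->
    {for p, continuous (fun p => F (frame Q p))}.
  by move=> cF; exact: (cvg_comp _ _ (@frame_continuous Q p) cF).
split.
- have -> : (fun u => f (frame Q (u, p.2))) =
      (fun u => f (p.2 *: row 1 Q^T + u *: delta_mx 0 i')).
    by apply/funext => u; rewrite /frame /= Q0 addrC.
  apply: is_derive_line.
  have -> : p.2 *: row 1 Q^T + p.1 *: delta_mx 0 i' = frame Q p.
    by rewrite /frame Q0 addrC.
  by apply: derivableP; have [] := fok _ pD i'.
- have -> : (fun u => f (frame Q (p.1, u))) =
      ((fun w => f (p.1 *: row 0 Q^T + w *: delta_mx 0 i)) \o (fun u => u * s)).
    by apply/funext => u; rewrite /frame /= Q1 scalerA.
  rewrite mulrC; apply: is_derive1_comp.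
    apply: is_derive_line.
    have -> : p.1 *: row 0 Q^T + (p.2 * s) *: delta_mx 0 i = frame Q p.
      by rewrite /frame Q1 scalerA.
    by apply: derivableP; have [] := fok _ pD i.
  apply: is_derive_eq; rewrite /GRing.scale /=; ring.
- by apply: cP; have [] := fok _ pD i'.
- by apply: cvgMl_tmp; apply: cP; have [] := fok _ pD i.
Qed.

Lemma C1_on_scale (B : set (R * R)) F Fs Ft (k : R) : C1_on B F Fs Ft ->
  C1_on B (fun p => k * F p) (fun p => k * Fs p) (fun p => k * Ft p).
Proof.
move=> C1F p pB; have [Ds Dt cs ct] := C1F p pB; split.
- exact: (is_deriveZ k Ds).
- exact: (is_deriveZ k Dt).
- by apply: cvgMl_tmp.
- by apply: cvgMl_tmp.
Qed.

Lemma within_closure_continuous D (f : 'rV[R]_2 -> R) x :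
  {within closure D, continuous f} -> open D -> D x -> {for x, continuous f}.
Proof.
move=> /subspace_continuousP cf oD Dx.
have := cf x (subset_closure Dx); rewrite /prop_for /continuous_at.
rewrite within_interior //.
by apply: (interiorS (@subset_closure _ D)); rewrite (interior_id D).1.
Qed.

Lemma extends_continuously_continuous D f x :
  open D -> extends_continuously D f -> D x -> {for x, continuous f}.
Proof.
move=> oD [F cF fF] Dx; have cFx := within_closure_continuous cF oD Dx.
have nearfF : \forall y \near x, F y = f y.
  have : nbhs x D by exact: open_nbhs_nbhs.
  by apply: filterS => y yD; rewrite fF ?inE.
rewrite /prop_for /continuous_at fF ?inE //.
exact: cvg_trans (near_eq_cvg nearfF) cFx.
Qed.

Lemma Ck_closure2_partials D g : open D -> Ck_closure 2 D g ->
  C1_partials D g /\ forall i, C1_partials D (partial i g).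
Proof.
move=> oD [cg [_ /= H]]; split => [x Dx j|i x Dx j].
  have [H1 [H2 _]] := H j; split; first exact: H1.
  exact: extends_continuously_continuous H2 Dx.
have [_ [_ H2]] := H i; have [H3 [H4 _]] := H2 j; split; first exact: H3.
exact: extends_continuously_continuous H4 Dx.
Qed.

(** Some partial derivative of [g] does not vanish at [x0].  Taking its axis,
    with the sign for which [g] decreases, as second coordinate, the implicit
    function theorem applies in the new coordinates. *)
Lemma level_set_graph D g x0 : open D -> Ck_closure 2 D g -> D x0 -> g x0 = 0 ->
  0 < eucl_norm (grad g x0) + `|g x0| ->
  exists (Q : 'M[R]_2) (f : R -> R) (r d : R),
    [/\ Q *m Q^T = 1%:M, Ck_line 2 f, 0 < r, 0 < d &
      forall x, `|(x *m Q) 0 0 - (x0 *m Q) 0 0| < r ->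
                `|(x *m Q) 0 1 - (x0 *m Q) 0 1| < d ->
        [/\ D x, f ((x *m Q) 0 0) < (x *m Q) 0 1 -> g x < 0 &
                 (x *m Q) 0 1 < f ((x *m Q) 0 0) -> 0 < g x]].
Proof.
move=> oD gC2 Dx0 gx0; rewrite gx0 normr0 addr0 => gr0.
have [i gi0] : exists i, partial i g x0 != 0.
  apply: contrapT => h; move: gr0; rewrite /eucl_norm big1 ?sqrtr0 ?ltxx //.
  move=> j _; rewrite mxE; apply/eqP; rewrite expf_eq0 /=.
  by apply: contrapT => hj; apply: h; exists j; apply/negP.
have [g1 g2] := Ck_closure2_partials oD gC2.
pose s : R := if 0 < partial i g x0 then -1 else 1.
have ss : s * s = 1 by rewrite /s; case: ifP => _; ring.
have sg : s * partial i g x0 < 0.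
  rewrite /s; case: ifP => h; first by rewrite mulN1r oppr_lt0.
  by rewrite mul1r lt_neqAle gi0 leNgt h.
(* The other index: addition in ['I_2] is modulo 2. *)
pose i' : 'I_2 := 1 + i.
pose Q : 'M[R]_2 :=
  \matrix_(a, b) if b == 0 then (a == i')%:R else s * (a == i)%:R.
have Q0 : row 0 Q^T = delta_mx 0 i' by apply/rowP => a; rewrite !mxE.
have Q1 : row 1 Q^T = s *: delta_mx 0 i by apply/rowP => a; rewrite !mxE.
have QQ : Q *m Q^T = 1%:M.
  apply: mulmx1C; apply/matrixP => a b; rewrite !mxE sum_ord2 !mxE.
  case: (ord2P i) (ord2P a) (ord2P b) => Ei [] -> [] ->;
    rewrite /i' Ei /= ?mulr0 ?mulr1 ?mul0r ?addr0 ?add0r ?ss //.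
pose q : R * R := ((x0 *m Q) 0 0, (x0 *m Q) 0 1).
have Pq : frame Q q = x0 by exact: frameK.
have [d d0 dP] : exists2 d, 0 < d & forall p, ball q d p ->
    D (frame Q p) /\ s * partial i g (frame Q p) < 0.
  have : \forall y \near x0, D y /\ s * partial i g y < 0.
    near=> y; split; near: y; first exact: open_nbhs_nbhs.
    have /cvgr_lt : {for x0, continuous (fun y => s * partial i g y)}.
      exact: cvgMl_tmp (g1 x0 Dx0 i).2.
    exact.
  rewrite -{1}Pq => /(@frame_continuous Q q) /nbhs_ballP [d /= d0 dH].
  by exists d => // p /dH.
have PD p : ball q d p -> D (frame Q p) by move=> /dP[].
have [r [f [r0 rd f2 fP]]] := implicit_C2 d0
  (C1_on_frame ss Q0 Q1 g1 PD) (C1_on_frame ss Q0 Q1 (g2 i') PD)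
  (C1_on_scale s (C1_on_frame ss Q0 Q1 (g2 i) PD)) (fun p pB => (dP p pB).2)
  (etrans (congr1 g Pq) gx0).
exists Q, f, r, d; split => // x xr xd.
have [fd fpos fneg] := fP _ xr.
have xE := frameK x QQ.
split.
- rewrite -xE; apply: PD; split; rewrite /ball /= distrC //.
  exact: lt_le_trans xr rd.
- by move=> /(fneg _ xd); rewrite xE.
- by move=> /(fpos _ xd); rewrite xE.
Unshelve. all: by end_near. Qed.

End Frame.

(** * Components of a regular sublevel set *)

Section Components.
Variable R : realType.

Lemma curve_component (T : topologicalType) (A : set T) (c : R -> T) (a b : R) :
  continuous c -> (forall u, a <= u <= b \/ b <= u <= a -> A (c u)) ->
  connected_component A (c a) (c b).
Proof.
move=> cc; wlog ab : a b / a <= b => [hwlog cA|cA].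
  case: (leP a b) => [|/ltW] ab; first exact: hwlog.
  by apply: connected_component_sym; apply: hwlog => // u hu; apply: cA; tauto.
apply: (@connected_component_max _ A (c @` `[a, b]) (c a)).
- by exists a => //=; rewrite in_itv /= lexx.
- by move=> _ [u /= +] <-; rewrite in_itv /= => hu; apply: cA; left.
- apply: connected_continuous_connected; first exact: segment_connected.
  exact: continuous_subspaceT.
- by exists b => //=; rewrite in_itv /= ab lexx.
Qed.

(** Balls are connected, being unions of segments from the centre. *)
Lemma open_connected_component (V : normedModType R) (A : set V) x :
  open A -> open (connected_component A x).
Proof.
move=> oA; rewrite openE => y Cy; have Ay := connected_component_sub Cy.
have /nbhs_ballP [e /= e0 eA] : nbhs y A by exact: open_nbhs_nbhs.
apply/nbhs_ballP; exists e => //= z; rewrite -ball_normE /= => yz.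
apply: (connected_component_trans Cy).
pose c (u : R) := y + u *: (z - y).
have c1 : c 1 = z by rewrite /c scale1r addrC subrK.
have c0 : c 0 = y by rewrite /c scale0r addr0.
have := @curve_component _ A c 0 1; rewrite c0 c1; apply.
  move=> u; apply: cvgD; [exact: cvg_cst|exact: cvgZr_tmp].
move=> u hu; have {hu} /andP[u0 u1] : 0 <= u <= 1.
  by case: hu => // /andP[? ?]; apply/andP; split; lra.
apply: eA; rewrite -ball_normE /= /c opprD addrA subrr add0r normrN normrZ.
rewrite (ger0_norm u0) -normrN opprB; apply: le_lt_trans yz.
by rewrite ler_piMl.
Qed.

(** Components of an open set are open, hence relatively closed. *)
Lemma component_closure_sub (V : normedModType R) (A : set V) x y :
  open A -> closure (connected_component A x) y -> A y ->
  connected_component A x y.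
Proof.
move=> oA cy Ay.
have /cy [z [Cxz Cyz]] : nbhs y (connected_component A y).
  apply: open_nbhs_nbhs; split; first exact: open_connected_component.
  exact: connected_component_refl.
exact: connected_component_trans Cxz (connected_component_sym Cyz).
Qed.

Variables (D : set 'rV[R]_2) (g : 'rV[R]_2 -> R).
Hypotheses (D_open : open D) (gC2 : Ck_closure 2 D g)
  (g_reg : forall x, D x -> 0 < eucl_norm (grad g x) + `|g x|)
  (g_bnd : forall x, boundary D x -> 0 < g x).

Lemma sublevelP x : sublevel D g x -> D x /\ g x <= 0.
Proof. exact: interior_subset. Qed.

Lemma open_sublevel : open (sublevel D g).
Proof. exact: open_interior. Qed.

(** Positivity of [g] on the boundary of [D] keeps the sublevel set off it. *)
Lemma closure_sublevel x : closure (sublevel D g) x -> D x /\ g x <= 0.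
Proof.
move=> cx.
have cDx : closure D x by apply: closureS cx => y /sublevelP[].
have gx : g x <= 0.
  rewrite leNgt; apply/negP => gx0.
  have /subspace_continuousP /(_ x cDx) /cvgr_gt /(_ _ gx0) := gC2.1.
  rewrite near_withinE => /cx [y [/sublevelP[Dy gy]]] /(_ (subset_closure Dy)).
  by rewrite ltNge gy.
split=> //; apply: contrapT => nDx.
have : boundary D x by split=> // /interior_subset.
by move=> /g_bnd; rewrite ltNge gx.
Qed.

Lemma sublevel_neg x : D x -> g x < 0 -> sublevel D g x.
Proof.
move=> Dx gx.
have /cvgr_lt /(_ _ gx) := within_closure_continuous gC2.1 D_open Dx.
have : nbhs x D by exact: open_nbhs_nbhs.
rewrite /sublevel /interior /=; apply: filterS2 => y Dy gy; split => //.
exact: ltW.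
Qed.

Lemma component_boundary_zero w x :
  boundary (connected_component (sublevel D g) w) x -> D x /\ g x = 0.
Proof.
set W := connected_component _ _ => -[cx nix].
have oW : open W by apply: open_connected_component; exact: open_sublevel.
have cAx : closure (sublevel D g) x.
  exact: closureS (@connected_component_sub _ _ _) _ cx.
have [Dx gx] := closure_sublevel cAx.
split=> //; apply/eqP; rewrite eq_le gx leNgt; apply/negP => gx0.
apply: nix; rewrite (interior_id W).1 //.
exact: component_closure_sub open_sublevel cx (sublevel_neg Dx gx0).
Qed.

(** Near a boundary point the sublevel set is the strict epigraph of a C2
    function.  That epigraph meets the component, and its part in a thin box is
    connected: any two of its points are joined by going up to the top edge of
    the box, along this edge, and down again; so it lies in the component. *)
Lemma component_of_class_C2 w :
  of_class_Ck 2 (connected_component (sublevel D g) w).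
Proof.
set A := sublevel D g; set W := connected_component A w => x0 bx0.
have [Dx0 gx0] := component_boundary_zero bx0.
have [Q [f [r [d [QQ f2 r0 d0 loc]]]]] :=
  level_set_graph D_open gC2 Dx0 gx0 (g_reg Dx0).
exists Q, f; split=> //.
pose s (x : 'rV[R]_2) : R := (x *m Q) 0 0.
pose t (x : 'rV[R]_2) : R := (x *m Q) 0 1.
have cs x : {for x, continuous s} by exact: coord_mulmx_continuous.
have ct x : {for x, continuous t} by exact: coord_mulmx_continuous.
have cf : continuous f by exact: (f2 0%N isT).1.
have sF p : s (frame Q p) = p.1 by have [] := frame_coord p QQ.
have tF p : t (frame Q p) = p.2 by have [] := frame_coord p QQ.
have FK x : frame Q (s x, t x) = x by exact: frameK.
have near_s x k : `|s x - s x0| < k -> \forall y \near x, `|s y - s x0| < k.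
  exact: near_dist_lt.
have near_t x k : `|t x - t x0| < k -> \forall y \near x, `|t y - t x0| < k.
  exact: near_dist_lt.
have loc_neg x : `|s x - s x0| < r -> `|t x - t x0| < d -> f (s x) < t x -> A x.
  move=> sr td ft; have [Dx gneg _] := loc x sr td.
  exact: sublevel_neg (gneg ft).
have cgamma a : continuous (fun u => frame Q (a, u)).
  move=> u; rewrite /frame /=.
  by apply: cvgD; [exact: cvg_cst|exact: cvgZr_tmp].
have cgamma' a : continuous (fun u => frame Q (u, a)).
  move=> u; rewrite /frame /=.
  by apply: cvgD; [exact: cvgZr_tmp|exact: cvg_cst].
have A_lt x : `|s x - s x0| < r -> `|t x - t x0| < d -> A x -> f (s x) < t x.
  move=> sr td Ax; rewrite ltNge; apply/negP => ft.
  (* Otherwise [g] would be positive just below [x], yet the sublevel set is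
     open. *)
  have h1 : \forall u \near t x, A (frame Q (s x, u)).
    have : nbhs x A by apply: open_nbhs_nbhs; split => //; exact: open_sublevel.
    by rewrite -{1}(FK x) => /(cgamma (s x) (t x)).
  have h2 : \forall u \near t x, `|u - t x0| < d.
    exact: (@near_dist_lt _ _ id).
  have /nbhs_ballP [e /= e0 eP] : \forall u \near t x,
      A (frame Q (s x, u)) /\ `|u - t x0| < d by exact: filterI h1 h2.
  pose u := t x - e / 2.
  have [|Au du] := eP u.
    by rewrite /ball /= /u opprD addrA subrr add0r opprK gtr0_norm; lra.
  have [_ _] : [/\ D (frame Q (s x, u)),
      f (s x) < u -> g (frame Q (s x, u)) < 0 &
      u < f (s x) -> 0 < g (frame Q (s x, u))].
    have := loc (frame Q (s x, u)).
    by rewrite -/(s (frame _ _)) -/(t (frame _ _)) sF tF; apply.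
  have [_ gle] := sublevelP Au.
  suff uf : u < f (s x) by move=> /(_ uf); rewrite ltNge gle.
  by apply: lt_le_trans ft; rewrite /u; lra.
(* The height of the top edge, above the graph for [s x] close to [s x0]. *)
pose t1 := t x0 + d / 2.
have t1d : `|t1 - t x0| < d by rewrite /t1 addrAC subrr add0r gtr0_norm; lra.
have f0 : f (s x0) = t x0.
  have [||_ gneg gpos] := loc x0; rewrite ?subrr ?normr0 //.
  apply/eqP; rewrite eq_le !leNgt; apply/andP; split; apply/negP => h.
    by move: (gpos h); rewrite gx0 ltxx.
  by move: (gneg h); rewrite gx0 ltxx.
have [r1 [r10 r1r fr1]] : exists r1, [/\ 0 < r1, r1 <= r &
    forall u, `|u - s x0| < r1 -> f u < t1].
  have /nbhs_ballP [e /= e0 eP] : \forall u \near s x0, f u < t1.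
    by have /cvgr_lt := cf (s x0); apply; rewrite f0 /t1 ltrDl divr_gt0.
  exists (Num.min e r); split; rewrite ?lt_min ?e0 ?ge_min ?lexx ?orbT //.
  by move=> u; rewrite lt_min => /andP[h _]; apply: eP; rewrite /ball /= distrC.
have to_top x : `|s x - s x0| < r1 -> `|t x - t x0| < d / 2 -> A x ->
    connected_component A x (frame Q (s x0, t1)).
  move=> sr1 td2 Ax; have sr := lt_le_trans sr1 r1r.
  have td : `|t x - t x0| < d by lra.
  have xt1 : t x <= t1.
    by move: td2; rewrite /t1 ltr_distl => /andP[_ h]; lra.
  have ft := A_lt x sr td Ax.
  apply: (@connected_component_trans _ _ (frame Q (s x, t1))).
    have := @curve_component _ A (fun u => frame Q (s x, u)) (t x) t1.
    rewrite FK; apply; first exact: cgamma.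
    move=> u hu; have {hu} /andP[u1 u2] : t x <= u <= t1.
      by case: hu => // /andP[h1 h2]; apply/andP; split; lra.
    apply: loc_neg; rewrite ?sF ?tF //=; last exact: lt_le_trans ft u1.
    move: td t1d; rewrite !ltr_distl => /andP[? ?] /andP[? ?].
    by apply/andP; split; lra.
  apply: (@curve_component _ A (fun u => frame Q (u, t1)) (s x) (s x0)).
    exact: cgamma'.
  move=> u hu.
  have ur1 : `|u - s x0| < r1.
    rewrite distrC; have : ball (s x0) r1 (s x) by rewrite /ball /= distrC.
    move=> /ball_between /(_ (ballxx _ r10)); apply; tauto.
  apply: loc_neg; rewrite ?sF ?tF //=; first exact: lt_le_trans r1r.
  exact: fr1.
have s00 : `|s x0 - s x0| < r1 by rewrite subrr normr0.
have t00 : `|t x0 - t x0| < d / 2 by rewrite subrr normr0 divr_gt0.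
have W_top : connected_component A w (frame Q (s x0, t1)).
  have N : nbhs x0 [set y | `|s y - s x0| < r1 /\
                            `|t y - t x0| < d / 2].
    by apply: filterI; [exact: near_s|exact: near_t].
  have [y [Wy [sy ty]]] := bx0.1 _ N.
  apply: (connected_component_trans Wy); apply: to_top => //.
  exact: connected_component_sub Wy.
near=> x.
have sx : `|s x - s x0| < r1 by near: x; exact: near_s.
have tx : `|t x - t x0| < d / 2 by near: x; exact: near_t.
have sr := lt_le_trans sx r1r.
have td : `|t x - t x0| < d by lra.
split=> [Wx|ft].
  exact: A_lt sr td (connected_component_sub Wx).
have Ax := loc_neg x sr td ft.
apply: connected_component_trans W_top _.
exact/connected_component_sym/to_top.
Unshelve. all: by end_near. Qed.

End Components.

(** * Smooth functions on the plane *)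

Section Smooth.
Variable R : realType.
Implicit Types (f g : 'rV[R]_2 -> R) (x v : 'rV[R]_2).

(** Class C^k on the whole plane.  Asking for total differentiability, rather
    than for partial derivatives only, makes the calculus of differentials
    available for sums, products and compositions. *)
Fixpoint smooth (k : nat) f : Prop :=
  if k is k'.+1 then
    (forall x, differentiable f x) /\ forall i, smooth k' (partial i f)
  else continuous f.

Lemma smoothW k f : smooth k.+1 f -> smooth k f.
Proof.
elim: k f => [|k IH] f [df pf].
  by move=> x; exact: differentiable_continuous.
by split => // i; apply: IH; exact: pf.
Qed.

Lemma smooth_continuous k f : smooth k f -> continuous f.
Proof. by elim: k => // k IH /smoothW. Qed.

Lemma smooth_cst k (c : R) : smooth k (cst c).
Proof.
elim: k c => [|k IH] c; first exact: cst_continuous.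
split=> [x|i]; first exact: differentiable_cst.
by rewrite (_ : partial i _ = cst 0) //; apply/funext => x; exact: derive_cst.
Qed.

Lemma smoothD k f g : smooth k f -> smooth k g -> smooth k (f + g).
Proof.
elim: k f g => [|k IH] f g.
  by move=> cf cg x; exact: continuousD (cf x) (cg x).
move=> [df pf] [dg pg]; split=> [x|i]; first exact: differentiableD.
rewrite (_ : partial i _ = partial i f + partial i g).
  exact: (IH _ _ (pf i) (pg i)).
apply/funext => x.
by apply: deriveD; apply: diff_derivable; [apply: df|apply: dg].
Qed.

Lemma smoothM k f g : smooth k f -> smooth k g -> smooth k (f * g).
Proof.
elim: k f g => [|k IH] f g.
  by move=> cf cg x; exact: continuousM (cf x) (cg x).
move=> f1 g1; have [df pf] := f1; have [dg pg] := g1.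
split=> [x|i]; first exact: differentiableM.
rewrite (_ : partial i _ = f * partial i g + g * partial i f).
  by apply: smoothD; [exact: (IH _ _ (smoothW f1) (pg i))|
                      exact: (IH _ _ (smoothW g1) (pf i))].
apply/funext => x.
by apply: deriveM; apply: diff_derivable; [apply: df|apply: dg].
Qed.

Lemma smooth_comp k (h : R -> R) f :
  Ck_line k h -> smooth k f -> smooth k (h \o f).
Proof.
elim: k h f => [|k IH] h f hk.
  move=> cf x; apply: continuous_comp; first exact: cf.
  exact: (hk 0%N isT).1.
move=> f1; have [df pf] := f1.
have dh y : derivable h y 1 by exact: (hk 0%N isT).2.
split=> [x|i].
  by apply: differentiable_comp => //; exact/derivable1_diffP.
rewrite (_ : partial i _ = (derive1 h \o f) * partial i f).
  apply: smoothM (pf i); apply: IH; last exact: (smoothW f1).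
  move=> n nk; have [] := hk n.+1 nk; rewrite derive1Sn => h1 h2.
  by split=> // nk'; exact: h2.
apply/funext => x; have dhx : differentiable h (f x) by exact/derivable1_diffP.
rewrite /partial deriveE; last exact: differentiable_comp.
by rewrite diff_comp //= diff1E // /GRing.scale /= mulrC -deriveE.
Qed.

Lemma derive_coord (x v : 'rV[R]_2) (i : 'I_2) :
  'D_v (fun y : 'rV[R]_2 => y 0 i) x = v 0 i.
Proof.
have dv : derivable (id : 'rV[R]_2 -> 'rV[R]_2) x v by exact: derivable_id.
by have := derive_mx dv; rewrite derive_id => {2}->; rewrite mxE.
Qed.

Lemma smooth_coord k i : smooth k (fun x => x 0 i).
Proof.
case: k => [|k]; first exact: (@coord_continuous R 1 2 0 i).
split=> [x|j]; first exact: differentiable_coord.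
rewrite (_ : partial j _ = cst ((delta_mx 0 j : 'rV[R]_2) 0 i)).
  exact: smooth_cst.
by apply/funext => x; exact: derive_coord.
Qed.

Lemma smooth_mulmx k (Q : 'M[R]_2) j : smooth k (fun x => (x *m Q) 0 j).
Proof.
rewrite (_ : (fun x => _) =
    (fun x => x 0 0) * cst (Q 0 j) + (fun x => x 0 1) * cst (Q 1 j)).
  by apply: smoothD; apply: smoothM;
    [exact: smooth_coord|exact: smooth_cst|
     exact: smooth_coord|exact: smooth_cst].
by apply/funext => y; rewrite mxE sum_ord2.
Qed.

Lemma smooth_derivs_extend k D f : smooth k f -> derivs_extend k D f.
Proof.
elim: k f => [|k IH] f sf.
  by split=> //; exists f => //; exact: continuous_subspaceT.
split; last first.
  move=> i; split; last by apply: IH; exact: sf.2.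
  by move=> x _; apply: diff_derivable; exact: sf.1.
by exists f => //; apply: continuous_subspaceT; exact: smooth_continuous sf.
Qed.

Lemma smooth_Ck_closure k D f : smooth k f -> Ck_closure k D f.
Proof.
move=> sf; split; last exact: smooth_derivs_extend.
by apply: continuous_subspaceT; exact: smooth_continuous sf.
Qed.

Lemma derive_sign f x v : derivable f x v -> 'D_v f x < 0 ->
  \forall u \near (0 : R), (0 < u -> f (x + u *: v) < f x) /\
                           (u < 0 -> f x < f (x + u *: v)).
Proof.
move=> fx fv.
have /is_derive1_caratheodory [A [fA cA A0]] := is_derive_line0 fx.
have A_lt : A 0 < 0 by rewrite A0.
have : \forall u \near (0 : R), A u < 0 by move/cvgr_lt: cA; apply.
apply: filterS => u Au; have := fA u; rewrite scale0r addr0 subr0 => fu.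
split=> u0.
  by rewrite -subr_lt0 fu nmulr_rlt0.
by rewrite -subr_gt0 fu nmulr_rgt0.
Qed.

Lemma derive_grad0 f x v : differentiable f x -> eucl_norm (grad f x) = 0 ->
  'D_v f x = 0.
Proof.
move=> df /eqP; rewrite sqrtr_eq0 => gr0.
have {}gr0 i : 'd f x (delta_mx 0 i) = 0.
  have h j : 0 <= (grad f x) 0 j ^+ 2 by exact: sqr_ge0.
  move: gr0; rewrite sum_ord2 => gr0.
  have : grad f x 0 i ^+ 2 = 0.
    by case: (ord2P i) => ->; have := h 0; have := h 1; lra.
  by move=> /eqP; rewrite sqrf_eq0 mxE /partial deriveE // => /eqP.
rewrite deriveE // [v]row_sum_delta linear_sum big1 // => i _.
by rewrite linearZ /= gr0 scaler0.
Qed.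

End Smooth.

(** * Global defining functions of C2 open sets *)

Section DefiningFunction.
Variables (R : realType) (W : set 'rV[R]_2).
Hypothesis W_open : open W.
Implicit Types (f q : 'rV[R]_2 -> R) (x v : 'rV[R]_2).

Definition inward x v := \forall u \near (0 : R), 0 < u -> W (x + u *: v).

(** The sign conditions are weak so that a local defining function times a bump
    qualifies.  They are stable under addition, and a sum is [sharp_at] a point
    as soon as one summand is.  This replaces a partition of unity. *)
Definition weakly_defining q :=
  [/\ smooth 2 q, (forall x, W x -> q x <= 0) & (forall x, ~ W x -> 0 <= q x)].

(** The derivative condition is tested only on directions that enter [W]: in
    those, no weakly defining function can increase, so the derivatives of
    different summands cannot cancel. *)
Definition sharp_at q x :=
  [/\ W x -> q x < 0, ~ closure W x -> 0 < q x &
      boundary W x -> exists2 v, inward x v & 'D_v q x < 0].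

Lemma boundary_notin x : boundary W x -> ~ W x.
Proof. by rewrite /boundary (interior_id W).1 // => -[]. Qed.

Lemma weakly_defining_boundary q x :
  weakly_defining q -> boundary W x -> q x = 0.
Proof.
move=> [sq qW qnW] bx; apply/eqP.
rewrite eq_le qnW ?andbT; last exact: boundary_notin.
rewrite leNgt; apply/negP => qx.
have N : \forall y \near x, 0 < q y.
  by have /cvgr_gt := smooth_continuous sq (x := x); apply.
have [y [Wy]] := bx.1 _ N.
by rewrite /= ltNge qW.
Qed.

Lemma weakly_defining_inward q x v : weakly_defining q -> boundary W x ->
  inward x v -> 'D_v q x <= 0.
Proof.
move=> wq bx iv; have qx := weakly_defining_boundary wq bx.
have [[dq _] qW _] := wq.
rewrite leNgt; apply/negP => Dq.
have dqx : derivable q x v by exact: diff_derivable.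
have Nq : 'D_v (- q) x < 0 by rewrite deriveN // oppr_lt0.
have [e e0 [[[H _] Wu] _]] :=
  near0_ex (filterI (derive_sign (derivableN dqx) Nq) iv).
have := H e0; rewrite /= !opprfctE qx oppr0 oppr_lt0 ltNge qW //.
exact: Wu.
Qed.

Lemma weakly_definingD q1 q2 : weakly_defining q1 -> weakly_defining q2 ->
  weakly_defining (q1 + q2).
Proof.
move=> [s1 n1 p1] [s2 n2 p2]; split; first exact: smoothD.
- move=> x Wx; rewrite -[leLHS]/(q1 x + q2 x).
  by have := n1 x Wx; have := n2 x Wx; lra.
- by move=> x Wx; apply: addr_ge0; [exact: p1|exact: p2].
Qed.

Lemma sharp_atD q1 q2 x : weakly_defining q1 -> weakly_defining q2 ->
  sharp_at q1 x -> sharp_at (q1 + q2) x.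
Proof.
move=> w1 w2 [n1 p1 b1].
have [[d1 _] _ _] := w1; have [[d2 _] n2 p2] := w2; split.
- move=> Wx; rewrite -[ltLHS]/(q1 x + q2 x).
  by have := n1 Wx; have := n2 x Wx; lra.
- by move=> Wx; apply: ltr_wpDr; [apply: p2 => /subset_closure|exact: p1].
- move=> bx; have [v iv Dv] := b1 bx; exists v => //.
  rewrite deriveD; [|exact: diff_derivable..].
  by have := weakly_defining_inward w2 bx iv; lra.
Qed.

(** Positive exactly on a Euclidean disc. *)
Definition bump (c : 'rV[R]_2) (r : R) : 'rV[R]_2 -> R :=
  @pos_cube R \o
  (fun x => r ^+ 2 - ((x 0 0 - c 0 0) ^+ 2 + (x 0 1 - c 0 1) ^+ 2)).

Lemma smooth_bump c r : smooth 2 (bump c r).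
Proof.
apply: smooth_comp; first exact: pos_cube_C2.
have s i : smooth 2 (fun x : 'rV[R]_2 => (x 0 i - c 0 i) ^+ 2).
  have si : smooth 2 ((fun x : 'rV[R]_2 => x 0 i) + cst (- c 0 i)).
    by apply: smoothD; [exact: smooth_coord|exact: smooth_cst].
  exact: (smoothM si si).
pose t := cst (r ^+ 2) + cst (-1) *
  ((fun x : 'rV[R]_2 => (x 0 0 - c 0 0) ^+ 2) +
   (fun x : 'rV[R]_2 => (x 0 1 - c 0 1) ^+ 2)).
rewrite (_ : (fun x => _) = t); last first.
  by apply/funext => x; rewrite -[LHS]/(_ - _) -mulN1r.
apply: smoothD; first exact: smooth_cst.
by apply: smoothM; [exact: smooth_cst|exact: smoothD].
Qed.

Lemma bump_ge0 c r x : 0 <= bump c r x.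
Proof. exact: pos_cube_ge0. Qed.

Lemma bump_gt0_ball c r x : 0 < r -> 0 < bump c r x -> ball c r x.
Proof.
move=> r0; rewrite /bump /= pos_cube_gt0 subr_gt0 => h; split=> // i j.
rewrite (ord1 i) /ball /= distrC -(ger0_norm (ltW r0)) -ltr_sqr ?nnegrE //.
rewrite !real_normK ?num_real //; apply: le_lt_trans h.
by case: (ord2P j) => ->; rewrite ?lerDl ?lerDr sqr_ge0.
Qed.

Lemma bump_near c r : 0 < r -> \forall x \near c, 0 < bump c r x.
Proof.
move=> r0; have cb := smooth_continuous (smooth_bump c r).
have /cvgr_gt := cb c; apply.
by rewrite /bump /= pos_cube_gt0 !subrr expr0n /= addr0 subr0 exprn_gt0.
Qed.

(** Multiplying by a bump supported where [f] describes [W] makes [f] globally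
    weakly defining; it stays sharp where the bump is positive. *)
Lemma local_weakly_defining f x0 : smooth 2 f ->
  (\forall x \near x0, (W x <-> f x < 0) /\
                       (f x = 0 -> exists v, 'D_v f x < 0)) ->
  exists2 q, weakly_defining q & \forall x \near x0, sharp_at q x.
Proof.
move=> sf /nbhs_ballP [e /= e0 eP].
pose b := bump x0 e.
have bB x : 0 < b x -> ball x0 e x by exact: bump_gt0_ball.
have b0 x : b x = 0 \/ 0 < b x.
  by have := bump_ge0 x0 e x; rewrite le_eqVlt => /predU1P[->|]; auto.
have wq : weakly_defining (b * f).
  split; first exact: (smoothM (smooth_bump x0 e) sf).
  - move=> x Wx; case: (b0 x) => bx; rewrite -[(b * f) x]/(b x * f x).
      by rewrite bx mul0r.
    have [[fW _] _] := eP x (bB x bx).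
    by rewrite pmulr_rle0 // ltW // fW.
  - move=> x Wx; case: (b0 x) => bx; rewrite -[(b * f) x]/(b x * f x).
      by rewrite bx mul0r.
    have [[_ fW] _] := eP x (bB x bx).
    by rewrite pmulr_rge0 // leNgt; apply/negP => /fW.
exists (b * f) => //; apply: filterS (bump_near x0 e0) => x bx.
have [fW fv] := eP x (bB x bx).
have [df _] := sf.
have inw v : f x = 0 -> 'D_v f x < 0 -> inward x v.
  move=> fx0 Dv; have dfx : derivable f x v by exact: diff_derivable.
  have xB : nbhs x (ball x0 e).
    by apply: open_nbhs_nbhs; split; [exact: ball_open|exact: bB].
  apply: filterS2 (near_line v xB) (derive_sign dfx Dv) => u xu [H _] u0.
  by apply/(eP _ xu).1; rewrite -fx0; exact: H.
split.
- by move=> Wx; rewrite -[_ x]/(b x * f x) pmulr_rlt0 //; exact/fW.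
- move=> ncx; rewrite -[_ x]/(b x * f x) pmulr_rgt0 // lt_neqAle.
  apply/andP; split.
    apply/negP => /eqP /esym fx0; apply: ncx.
    have [v Dv] := fv fx0; have iv := inw v fx0 Dv.
    move=> B Bx.
    have [u u0 [[Wu Bu] _]] := near0_ex (filterI iv (near_line v Bx)).
    by exists (x + u *: v); split => //; exact: Wu.
  rewrite leNgt; apply/negP => /fW.
  by apply: contra_not ncx; exact: subset_closure.
- move=> bdx.
  have fx0 : f x = 0.
    have := weakly_defining_boundary wq bdx; rewrite -[_ x]/(b x * f x) => /eqP.
    by rewrite mulf_eq0 gt_eqF //= => /eqP.
  have [v Dv] := fv fx0; exists v; first exact: inw.
  have [db _] := smooth_bump x0 e.
  rewrite deriveM; [|exact: diff_derivable..].
  by rewrite fx0 scale0r addr0 /GRing.scale /= pmulr_rlt0.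
Qed.

Hypothesis W_C2 : of_class_Ck 2 W.

(** Inside [W] and outside its closure constants serve.  At a boundary point
    take the height of the bounding graph minus the second coordinate, whose
    derivative along the second axis is -1. *)
Lemma exists_local_weakly_defining x0 :
  exists2 q, weakly_defining q & \forall x \near x0, sharp_at q x.
Proof.
have [Wx0|nWx0] := pselect (W x0).
  apply: (@local_weakly_defining (cst (-1))); first exact: smooth_cst.
  have : nbhs x0 W by exact: open_nbhs_nbhs.
  by apply: filterS => x Wx /=; split; [split=> // _; rewrite ltrN10|lra].
have [cx0|ncx0] := pselect (closure W x0); last first.
  apply: (@local_weakly_defining (cst 1)); first exact: smooth_cst.
  have : nbhs x0 (~` closure W).
    apply: open_nbhs_nbhs; split => //.
    by apply: closed_openC; exact: closed_closure.
  apply: filterS => x ncx /=; split; last lra.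
  by split=> [/subset_closure //|]; lra.
have bx0 : boundary W x0 by split => // /interior_subset.
have [Q [h [QQ h2 nearW]]] := W_C2 bx0.
pose f := (h \o (fun x : 'rV[R]_2 => (x *m Q) 0 0)) +
  cst (-1) * (fun x => (x *m Q) 0 1).
have fE x : f x = h ((x *m Q) 0 0) - (x *m Q) 0 1.
  by rewrite -[LHS]/(_ + -1 * _) mulN1r.
have sf : smooth 2 f.
  apply: smoothD; first by apply: smooth_comp => //; exact: smooth_mulmx.
  by apply: smoothM; [exact: smooth_cst|exact: smooth_mulmx].
apply: (local_weakly_defining sf).
apply: filterS nearW => x Wx; split; first by rewrite fE subr_lt0.
move=> _; exists (row 1 Q^T).
have dfx : derivable f x (row 1 Q^T) by apply: diff_derivable; exact: sf.1.
have := is_derive_line0 dfx.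
rewrite (_ : (fun w => _) = (fun w => f x - w)); last first.
  apply/funext => w; have QQ' := mulmx1C QQ.
  rewrite !fE !mulmxDl -!scalemxAl -!row_mul QQ' !mxE /= mulr0 addr0 mulr1.
  by rewrite opprD addrA.
move=> [_ <-].
have [_ ->] : is_derive (0 : R) 1 (fun w => f x - w) (-1); last lra.
by apply: is_derive_eq; rewrite /=; lra.
Qed.

(** By compactness [K] is covered by finitely many regions of sharpness; the sum
    of the corresponding functions is sharp on all of them. *)
Lemma exists_defining_on (K : set 'rV[R]_2) : compact K ->
  exists2 q, weakly_defining q & forall x, K x -> sharp_at q x.
Proof.
move=> cK.
have /choice [q_ q_P] : forall x0, exists q,
    weakly_defining q /\ \forall x \near x0, sharp_at q x.
  by move=> x0; have [q q1 q2] := exists_local_weakly_defining x0; exists q.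
have sumP (s : seq 'rV[R]_2) : exists2 q, weakly_defining q &
    forall i x, i \in s -> sharp_at (q_ i) x -> sharp_at q x.
  elim: s => [|i s [q wq qs]].
    by exists (q_ 0) => //; exact: (q_P 0).1.
  exists (q_ i + q); first by apply: weakly_definingD => //; exact: (q_P i).1.
  move=> j x; rewrite inE => /predU1P[->|js] sj.
    by apply: sharp_atD => //; exact: (q_P i).1.
  rewrite addrC; apply: sharp_atD => //; first exact: (q_P i).1.
  exact: qs sj.
move: cK; rewrite compact_cover.
move=> /(_ _ setT (fun i => interior [set x | sharp_at (q_ i) x])); case.
- by move=> i _; exact: open_interior.
- by move=> x _; exists x => //; exact: (q_P x).2.
- move=> s _ Ks; have [q wq qs] := sumP (finmap.enum_fset s).
  exists q => // x /Ks [i /= si /interior_subset]; exact: qs.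
Qed.

End DefiningFunction.

(** * The characterisation of admissible shapes *)

Lemma bounded_closure (R : realType) (V : normedModType R) (A : set V) :
  bounded_set A -> bounded_set (closure A).
Proof.
move=> [M [Mr MA]]; exists M; split=> // k /MA kA.
have ck : closed [set x : V | `|x| <= k].
  by apply: (@closed_comp _ _ _ [set y | y <= k]);
    [move=> x _; exact: norm_continuous|exact: closed_le].
by move=> x cx; rewrite ((closure_id _).1 ck); exact: closureS cx.
Qed.

(** At a boundary point of [W] the defining function is positive on one side, so
    taking the interior removes the boundary. *)
Lemma sublevel_defining (R : realType) (D W : set 'rV[R]_2)
    (q : 'rV[R]_2 -> R) :
  open W -> W `<=` D -> weakly_defining W q ->
  (forall x, D x -> sharp_at W q x) -> sublevel D q = W.
Proof.
move=> oW WD wq sq; have [[dq _] q_le _] := wq.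
apply/seteqP; split=> [x Ax|]; last first.
  rewrite /sublevel -open_subsetE // => x Wx; split; [exact: WD|exact: q_le].
apply: contrapT => nWx; have [Dx qx] := sublevelP Ax.
have [_ q_out q_bnd] := sq x Dx.
have [cx|/q_out] := pselect (closure W x); last by rewrite ltNge qx.
have bx : boundary W x by split=> // /interior_subset.
have [v _ Dv] := q_bnd bx.
have qx0 := weakly_defining_boundary oW wq bx.
have dqx : derivable q x v by exact: diff_derivable.
have [e e0 [_ [[_ qe] [_ qle]]]] :=
  near0_ex (filterI (derive_sign dqx Dv) (near_line v Ax)).
by have := qe; rewrite qx0 oppr_lt0 => /(_ e0); rewrite ltNge qle.
Qed.

Theorem proposition2p9 (R : realType) (D E : set 'rV[R]_2)
    (D_dom : is_domain D) (D_bnd : bounded_set D) (D_C11 : of_class_C11 D)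
    (E_dom : is_domain E) (E_neq0 : E !=set0) (ED : E `<=` D)
    (E_dist : (0 < set_dist (closure E) (boundary D))%E) :
  admissible_shapes D E =
  [set W | [/\ W `<=` D, is_domain W, of_class_Ck 2 W, E `<=` W &
               boundary W `&` boundary D = set0]].
Proof.
have [oD _] := D_dom; apply/seteqP; split=> W.
- move=> [g [gC2 _ g_reg g_bnd] [[w Aw ->] EW]]; split => //.
  + by move=> x /connected_component_sub /sublevelP[].
  + split; last exact: component_connected.
    exact/open_connected_component/open_sublevel.
  + exact: component_of_class_C2.
  + apply/seteqP; split=> // x.
    move=> [/(component_boundary_zero oD gC2 g_bnd)[Dx _]] [_].
    by rewrite (interior_id D).1.
- move=> [WD [oW cW] WC2 EW bWD].
  have K_compact : compact (closure D).
    apply: bounded_closed_compact; last exact: closed_closure.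
    exact: bounded_closure.
  have [q wq sq] := exists_defining_on oW WC2 K_compact.
  have [sm q_le q_ge] := wq; have [dq _] := sm.
  have [e Ee] := E_neq0.
  have sqD x : D x -> sharp_at W q x by move=> /subset_closure; exact: sq.
  exists q.
    split.
    + exact: smooth_Ck_closure.
    + by move=> x Ex; have [+ _ _] := sqD x (ED x Ex); apply; exact: EW.
    + move=> x Dx; have [q_in q_out q_bnd] := sqD x Dx.
      rewrite lt_neqAle addr_ge0 ?sqrtr_ge0 // andbT eq_sym.
      rewrite paddr_eq0 ?sqrtr_ge0 //; apply/negP => /andP[/eqP gr0].
      rewrite normr_eq0 => /eqP qx0.
      have [Wx|nWx] := pselect (W x).
        by have := q_in Wx; rewrite qx0 ltxx.
      have [cx|ncx] := pselect (closure W x); last first.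
        by have := q_out ncx; rewrite qx0 ltxx.
      have [|v _] := q_bnd; first by split=> // /interior_subset.
      by rewrite derive_grad0 // ltxx.
    + move=> x bx; have [_ q_out _] := sq x bx.1.
      apply: q_out => cx; have : (boundary W `&` boundary D) x.
        split=> //; split=> //; rewrite (interior_id W).1 // => /WD.
        by move: bx.2; rewrite (interior_id D).1.
      by rewrite bWD.
  split=> //; rewrite (sublevel_defining oW WD wq sqD).
  exists e; first exact: EW.
  by rewrite connected_component_id //; exact: EW.
Qed.
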